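(* The type function $\tau:\mathbb{R}\setminus\mathbb{Q}\to[1,\infty]$ is $[1,\infty]$-upper semi-Baire class $1$ complete.
   Context: For real $x$, $\|x\|:=\min_{n\in\mathbb{Z}}|x-n|$ denotes the distance from $x$ to the nearest integer. For an irrational real number $\alpha$, the type of $\alpha$ is $$\tau(\alpha):=\sup\big\{\theta\in\mathbb{R}:\liminf_{q\to\infty,\ q\in\mathbb{N}} q^\theta\|q\alpha\|=0\big\}\in[1,\infty].$$ The space $\mathbb{R}\setminus\mathbb{Q}$ carries the topology inherited from $\mathbb{R}$; it is a Polish space. Let $K\subset\overline{\mathbb{R}}=\mathbb{R}\cup\{-\infty,\infty\}$. A function $f$ from a Polish space $X$ into $K$ is upper semi-Baire class $1$ if $f^{-1}([-\infty,r))$ is a $\mathbf{\Sigma}^0_2$ (that is, $F_\sigma$) subset of $X$ for every real number $r$. An upper semi-Baire class $1$ function $f:X\to K$ is called $K$-upper semi-Baire class $1$ complete if for every upper semi-Baire class $1$ function $g:2^\omega\to K$ there exists a continuous function $\phi:2^\omega\to X$ such that $g=f\circ\phi$. Here $2^\omega=\{0,1\}^{\mathbb{N}}$ is the Cantor space. *)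

(* Defs.v *)
From HB Require Import structures.
From mathcomp Require Import all_boot all_order all_algebra.
From mathcomp Require Import all_classical all_reals all_analysis.
From mathcomp Require Import borel_hierarchy cantor.
Set Implicit Arguments.
Unset Strict Implicit.
Unset Printing Implicit Defensive.
Import Order.TTheory GRing.Theory Num.Theory.
Import numFieldNormedType.Exports.
Local Open Scope classical_set_scope.
Local Open Scope ring_scope.

(* The infimum is attained, so this is the minimum over the integers. *)
Definition dist_nearest_int (R : realType) (x : R) : R :=
  inf [set `|x - n%:~R| | n in [set: int]].

Definition irr_type (R : realType) (alpha : R) : \bar R :=
  ereal_sup [set theta%:E | theta in
    [set theta : R |
      limn_einf (fun q : nat =>
        (q%:R `^ theta * dist_nearest_int (q%:R * alpha))%:E) = 0%E]].

(* Functions into a subset K of the extended reals are represented as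
   functions into \bar R all of whose values lie in K. *)
Definition upper_semi_Baire1 (R : realType) (X : topologicalType)
    (K : set (\bar R)) (f : X -> \bar R) : Prop :=
  (forall x, K (f x)) /\
  (forall r : R, Fsigma (f @^-1` `[-oo%E, r%:E[)).

Definition upper_semi_Baire1_complete (R : realType) (X : topologicalType)
    (K : set (\bar R)) (f : X -> \bar R) : Prop :=
  upper_semi_Baire1 K f /\
  (forall g : cantor_space -> \bar R, upper_semi_Baire1 K g ->
     exists phi : cantor_space -> X, continuous phi /\ g = f \o phi).

(* Main.v *)
Require Import Defs.
From mathcomp Require Import all_boot all_order all_algebra.
From mathcomp Require Import all_classical all_reals all_analysis.
From mathcomp Require Import zify ring lra.
Import Order.TTheory GRing.Theory Num.Theory.
Import numFieldNormedType.Exports.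
Local Open Scope classical_set_scope.
Local Open Scope ring_scope.
Set Implicit Arguments.
Unset Strict Implicit.
Unset Printing Implicit Defensive.

(** Why the theorem holds.

Upper semi-Baire class 1.  The inequality [irr_type x < r] says that for some
[k] the exponent [t = r - 1/(k+1)] fails, and failure of [t] means that
[q^t * |q x - n|] stays above some [1/(j+1)] for all [q >= N] and all integers
[n].  For fixed [k], [j], [N] this is an intersection of closed conditions on
[x], and there are countably many triples ([irr_type_upper_semi_Baire1]).  That
the values are at least 1 is Dirichlet's pigeonhole theorem
([irr_type_ge1]).

Completeness, arithmetic half.  Given real exponents [h 0, h 1, ...], all at
least 1, an irrational number is built whose type is the upper limit of [h].
It is squeezed between fractions [p/q < r/s] with [r q - p s = 1]; one step
replaces [p/q] by [(p + a r)/(q + a s)] and then [r/s] by the mediant of the new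
left fraction and [r/s].  This is the continued fraction whose partial
quotients are alternately [a] and 1, so the two denominators of a stage stay
within a factor 2 of each other, and both endpoints move monotonically.  With
[a] close to [q^(h n - 1)] the next denominator is [q^(h n)] up to a constant
factor.  The quantity [gap n = r - s x] equals the inverse of the next
denominator up to a factor 2 ([gap_le], [gap_ge]), it is attained at the
denominator [s], and it bounds [|Q x - P|] from below for every positive [Q]
smaller than the next left denominator ([gap_best]).  Hence exactly the
exponents below the upper limit of [h] are approximable, the limit value itself
being left open ([exponents_irr_type]).  The number depends continuously on
[h], because its first [n] fractions depend only on the first [n] exponents.

Completeness, topological half.  It remains to write a given function [g] of
upper semi-Baire class 1 on the Cantor space as [limsup_n (h x n)], where
[h x n >= 1] depends only on the first [n] bits of [x]
([upper_semi_Baire1_exponents]).  The sets where [g] lies below a rational are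
unions of closed sets; this gives closed sets [C m] and rationals [rho m] with
[g < rho m] on [C m].  When it becomes visible from finitely many bits that [x]
avoids all [C i] with [i <= m] and [rho i <= rho m], the index [m] fires, once,
and pushes the exponent up to [rho m].  If [rho m <= g x] then [m] fires, and
each rational occurs as [rho m] for arbitrarily large [m], so the upper limit is
at least [g x].  If [x] belongs to [C i] then no [m >= i] with [rho m >= rho i]
ever fires, so the upper limit is at most [rho i] (or 1). *)

(** * The type of a number and approximable exponents *)

(** The condition [liminf q^t * ||q x|| = 0] with the distance to the nearest
integer replaced by a choice of the integer [n]; in this form its negation is
visibly a countable union of closed conditions on [x]. *)
Definition approximable (R : realType) (x t : R) : Prop :=
  forall e : R, 0 < e -> forall N : nat, exists q : nat, exists n : int,
    (N <= q)%N /\ q%:R `^ t * `|q%:R * x - n%:~R| < e.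

Lemma dist_nearest_int_ge0 (R : realType) (x : R) : 0 <= dist_nearest_int x.
Proof.
apply: lb_le_inf => [|_ [n _ <-]]; last exact: normr_ge0.
by exists `|x - 0%:~R|, 0.
Qed.

Lemma dist_nearest_int_le (R : realType) (x : R) (n : int) :
  dist_nearest_int x <= `|x - n%:~R|.
Proof.
apply: ge_inf; last by exists n.
by exists 0 => _ [m _ <-]; exact: normr_ge0.
Qed.

Lemma dist_nearest_int_lt (R : realType) (x e : R) :
  dist_nearest_int x < e -> exists n : int, `|x - n%:~R| < e.
Proof.
move=> /inf_lt[|_ [n _ <-] ?]; last by exists n.
by exists `|x - 0%:~R|, 0.
Qed.

Lemma limn_einf_eq0 (R : realType) (u : nat -> R) : (forall n, 0 <= u n) ->
  limn_einf (fun n => (u n)%:E) = 0%E <->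
  (forall e, 0 < e -> forall N, exists2 n, (N <= n)%N & u n < e).
Proof.
move=> u0; rewrite limn_einf_lim (cvg_lim _ (@cvg_einfs_sup _ _))//.
have einfs_ge0 n : (0 <= einfs (fun n => (u n)%:E) n)%E.
  by apply: le_ereal_inf_tmp => _ [m _ <-]; rewrite lee_fin.
split=> [s0 e e0 N|H].
  have : (einfs (fun n => (u n)%:E) N < e%:E)%E.
    apply: (@le_lt_trans _ _ 0%E); last by rewrite lte_fin.
    by rewrite -s0; apply: ereal_sup_ubound; exists N.
  by move=> /ereal_inf_lt[_ [n /= Nn <-]]; rewrite lte_fin => ?; exists n.
apply/eqP; rewrite eq_le; apply/andP; split; last first.
  by apply: (le_trans (einfs_ge0 0%N)); apply: ereal_sup_ubound; exists 0%N.
apply: ge_ereal_sup => _ [N _ <-].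
apply/lee_addgt0Pr => e e0; rewrite add0e.
have [n Nn une] := H _ e0 N.
apply: (@le_trans _ _ (u n)%:E); last by rewrite lee_fin ltW.
by apply: ereal_inf_lbound; exists n.
Qed.

Lemma approximableP (R : realType) (x t : R) :
  limn_einf (fun q : nat =>
    (q%:R `^ t * dist_nearest_int (q%:R * x))%:E) = 0%E <-> approximable x t.
Proof.
rewrite limn_einf_eq0; last first.
  by move=> q; rewrite mulr_ge0 ?powR_ge0 ?dist_nearest_int_ge0.
split=> H e e0 N.
  have [q Nq qe] := H e e0 N; exists q.
  (* The factor vanishes when [q = 0] and [t <> 0]; any [n] then works. *)
  have [q0|q0] := eqVneq ((q%:R : R) `^ t) 0.
    by exists 0; rewrite q0 mul0r.
  have qt0 : 0 < (q%:R : R) `^ t by rewrite lt_def q0 powR_ge0.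
  move: qe; rewrite mulrC -ltr_pdivlMr// => /dist_nearest_int_lt[n].
  by rewrite ltr_pdivlMr// mulrC => ?; exists n.
have [q [n [Nq qn]]] := H e e0 N; exists q => //.
by apply: le_lt_trans qn; rewrite ler_wpM2l ?powR_ge0 ?dist_nearest_int_le.
Qed.

(** The set of approximable exponents is downward closed, so a single exponent
bounds the type from below or from above according to whether it belongs to
the set. *)
Lemma approximable_le (R : realType) (x s t : R) : s <= t ->
  approximable x t -> approximable x s.
Proof.
move=> st H e e0 N; have [q [n [Nq qn]]] := H e e0 (maxn N 1).
move: Nq; rewrite geq_max => /andP[Nq q1]; exists q, n; split => //.
by apply: le_lt_trans qn; rewrite ler_wpM2r// ler_powR// ler1n.
Qed.

Lemma irr_type_ge (R : realType) (x t : R) :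
  approximable x t -> (t%:E <= irr_type x)%E.
Proof. by move=> /approximableP ?; apply: ereal_sup_ubound; exists t. Qed.

Lemma irr_type_le (R : realType) (x t : R) :
  ~ approximable x t -> (irr_type x <= t%:E)%E.
Proof.
move=> nt; apply: ge_ereal_sup => _ [s /= /approximableP xs <-].
rewrite lee_fin leNgt; apply/negP => ts.
by apply: nt; apply: approximable_le xs; exact: ltW.
Qed.

(** Only countably many exponents are needed to detect that the type is below
[r]; this is what makes the union of closed sets countable. *)
Lemma irr_type_lt (R : realType) (x r : R) :
  (irr_type x < r%:E)%E -> exists k, ~ approximable x (r - k.+1%:R^-1).
Proof.
move=> xr; apply: contrapT => /forallNP H.
suff : (r%:E <= irr_type x)%E by rewrite leNgt xr.
apply/lee_subgt0Pr => e e0.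
pose k := Num.truncn e^-1.
have ke : k.+1%:R^-1 < e.
  by rewrite -[ltRHS]invrK ltf_pV2 ?posrE ?invr_gt0// truncnS_gt.
have /contrapT/irr_type_ge := H k; apply: le_trans.
by rewrite -EFinB lee_fin lerB// ltW.
Qed.

Lemma not_approximable_separated (R : realType) (x t : R) :
  ~ approximable x t <-> exists j N : nat, forall q : nat, (N <= q)%N ->
    forall n : int, j.+1%:R^-1 <= q%:R `^ t * `|q%:R * x - n%:~R|.
Proof.
split=> [nt|[j [N sep]] ap]; last first.
  have [|q [n [Nq]]] := ap (j.+1%:R^-1) _ N; first by rewrite invr_gt0 ltr0n.
  by rewrite ltNge sep.
apply: contrapT => nsep; apply: nt => e e0 N; apply: contrapT => nq; apply: nsep.
exists (Num.truncn e^-1), N => q Nq n; rewrite leNgt; apply/negP => lt_e.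
apply: nq; exists q, n; split => //; apply: lt_trans lt_e _.
by rewrite -[ltRHS]invrK ltf_pV2 ?posrE ?invr_gt0// truncnS_gt.
Qed.

Lemma closed_separated (R : realType) (A : set R) (t e : R) (N : nat) :
  closed [set x : set_type A | forall q : nat, (N <= q)%N -> forall n : int,
    e <= q%:R `^ t * `|q%:R * set_val x - n%:~R|].
Proof.
rewrite (_ : mkset _ = \bigcap_(q in [set q | (N <= q)%N])
  \bigcap_(n in [set: int]) [set x : set_type A |
    e <= q%:R `^ t * `|q%:R * set_val x - n%:~R|]); last first.
  by apply/seteqP; split => x /= H q Nq n; [move=> _; exact: H|exact: H].
apply: closed_bigI => q _; apply: closed_bigI => n _.
pose f y := q%:R `^ t * `|q%:R * y - n%:~R|.
have fc : continuous f.
  move=> y; apply: cvgMl_tmp; apply: cvg_norm.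
  by apply: cvgB; [apply: cvgMl_tmp; exact: cvg_id|exact: cvg_cst].
apply: (@preimage_closed _ _ (f \o set_val) _ _ (@closed_ge R e)) => x _.
exact: (continuous_comp (@initial_continuous _ _ set_val x) (fc _)).
Qed.

(** * Dirichlet's theorem: the type is at least 1 *)

(** Pigeonhole: among the [M + 1] fractional parts of [0, x, ..., M x] two fall
into the same of the [M] boxes of length [1/M]. *)
Lemma dirichlet_approximation (R : realType) (x : R) (M : nat) : (0 < M)%N ->
  exists q : nat, exists n : int,
    (0 < q <= M)%N /\ `|q%:R * x - n%:~R| < M%:R^-1.
Proof.
move=> M0; have M0' : 0 < M%:R :> R by rewrite ltr0n.
pose fr (i : 'I_M.+1) : R := i%:R * x - (Num.floor (i%:R * x))%:~R.
have fr_ge0 i : 0 <= fr i by rewrite subr_ge0 ge_floor.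
have fr_lt1 i : fr i < 1.
  by have := floorD1_gt (i%:R * x); rewrite intrD /fr; lra.
have box_lt i : (Num.truncn (M%:R * fr i) < M)%N.
  rewrite truncn_lt_nat ?mulr_ge0 ?ler0n//.
  by rewrite -[ltRHS]mulr1 ltr_pM2l.
pose box i := Ordinal (box_lt i).
have /injectivePn[i [j ij bij]] : ~~ injectiveb box.
  apply/negP => /injectiveP/leq_card; by rewrite !card_ord ltnn.
have close k l : box k = box l -> M%:R * (fr k - fr l) < 1.
  move=> /(congr1 val) /= kl.
  have := truncnS_gt (M%:R * fr k); have := @truncn_le _ (M%:R * fr l).
  rewrite mulr_ge0 ?ler0n// kl -natr1; lra.
wlog lij : i j ij bij / (i < j)%N => [hw|].
  case: (ltngtP i j) => [|/hw|/val_inj ij']; first exact: hw.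
    by apply => //; rewrite eq_sym.
  by rewrite ij' eqxx in ij.
exists (j - i)%N, (Num.floor (j%:R * x) - Num.floor (i%:R * x))%R.
split; first by rewrite subn_gt0 lij (leq_trans (leq_subr _ _))// -ltnS.
rewrite natrB 1?ltnW// intrB.
rewrite (_ : _ - _ = fr j - fr i); last by rewrite /fr; ring.
have c1 := close _ _ bij; have c2 := close _ _ (esym bij).
rewrite -[ltRHS]div1r ltr_pdivlMr// mulrC -{1}(gtr0_norm M0') -normrM ltr_norml.
by apply/andP; split; lra.
Qed.

(** Forces the denominators given by Dirichlet's theorem to be large: finitely
many denominators cannot approximate an irrational arbitrarily well. *)
Lemma irrational_separated (R : realType) (x : R) (N : nat) : irrational x ->
  exists2 d : R, 0 < d & forall q : nat, (0 < q < N)%N -> forall n : int,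
    d <= `|q%:R * x - n%:~R|.
Proof.
move=> irr; elim: N => [|N [d d0 IH]]; first by exists 1 => // -[].
have [->|N0] := posnP N.
  by exists 1 => // -[|[]].
have nint (n : int) : N%:R * x != n%:~R.
  apply/eqP => Nxn; apply: irr; apply/rationalP; exists n, N.
  by rewrite -Nxn mulrC mulKf// pnatr_eq0 -lt0n.
set y := N%:R * x in nint.
have y1 : 0 < y - (Num.floor y)%:~R by rewrite subr_gt0 lt_neqAle eq_sym nint ge_floor.
have y2 : 0 < (Num.floor y)%:~R + 1 - y.
  by rewrite subr_gt0 -intrD1 floorD1_gt.
exists (Num.min d (Num.min (y - (Num.floor y)%:~R)
  ((Num.floor y)%:~R + 1 - y))); first by rewrite !lt_min d0 y1 y2.
move=> q /andP[q0]; rewrite ltnS leq_eqVlt => /predU1P[->{q q0}|qN] n.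
  rewrite !ge_min -/y.
  have [nf|fn] := leP n (Num.floor y).
    have : n%:~R <= (Num.floor y)%:~R :> R by rewrite ler_int.
    move=> ?; rewrite ger0_norm; last by lra.
    by apply/orP; right; apply/orP; left; lra.
  have : (Num.floor y)%:~R + 1 <= n%:~R :> R.
    by rewrite -intrD1 ler_int lezD1.
  move=> ?; rewrite ler0_norm; last by lra.
  by apply/orP; right; apply/orP; right; lra.
by rewrite ge_min IH// q0.
Qed.

Lemma powR_unbounded (R : realType) (t B : R) : 0 < t ->
  exists N : nat, forall q : nat, (N <= q)%N -> B < q%:R `^ t.
Proof.
move=> t0; pose B' := Num.max B 0; exists (Num.truncn (B' `^ t^-1)).+1 => q Nq.
apply: (@le_lt_trans _ _ B'); first by rewrite le_max lexx.
have B'0 : 0 <= B' by rewrite le_max lexx orbT.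
have -> : B' = (B' `^ t^-1) `^ t by rewrite -powRrM mulVf ?lt0r_neq0// powRr1.
apply: gt0_ltr_powR; rewrite ?nnegrE ?powR_ge0 ?ler0n//.
by apply: lt_le_trans (truncnS_gt _) _; rewrite ler_nat.
Qed.

Lemma irrational_approximable (R : realType) (x t : R) : irrational x ->
  0 <= t < 1 -> approximable x t.
Proof.
move=> irr /andP[t0 t1] e e0 N.
have [d d0 sep] := irrational_separated N irr.
(* Dirichlet gives [q^t * |q x - n| <= M^(t - 1)], which is below [e] for large
   [M] since [t < 1]. *)
have [M1 HM1] : exists N : nat, forall q : nat, (N <= q)%N ->
    e^-1 < (q%:R : R) `^ (1 - t) by apply: powR_unbounded; rewrite subr_gt0.
pose M := maxn M1 (Num.truncn d^-1).+1.
have M0 : (0 < M)%N by rewrite leq_max orbT.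
have M0' : 0 < M%:R :> R by rewrite ltr0n.
have [q [n [/andP[q0 qM] qxn]]] := dirichlet_approximation x M0.
exists q, n; split.
  rewrite leqNgt; apply/negP => qN.
  have := sep q _ n; rewrite q0 qN => /(_ isT); apply/negP; rewrite -ltNge.
  apply: (lt_trans qxn); rewrite -[ltRHS]invrK ltf_pV2 ?posrE ?invr_gt0//.
  by apply: lt_le_trans (truncnS_gt _) _; rewrite ler_nat leq_maxr.
apply: (@le_lt_trans _ _ (M%:R `^ t * M%:R^-1)).
  apply: ler_pM; rewrite ?powR_ge0 ?normr_ge0 ?(ltW qxn)//.
  by apply: ge0_ler_powR; rewrite ?nnegrE ?ler0n ?ler_nat.
rewrite -powR_inv1 ?ler0n// -powRD; last by apply/implyP => _; rewrite gt_eqF.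
rewrite -[t + -1]opprB powRN -[ltRHS]invrK ltf_pV2 ?posrE ?invr_gt0 ?powR_gt0//.
by apply: HM1; rewrite leq_maxl.
Qed.

(** Every exponent in [0, 1) is approximable; if the type were below 1, the
midpoint between the type and 1 would be such an exponent. *)
Lemma irr_type_ge1 (R : realType) (x : R) : irrational x ->
  (1%:E <= irr_type x)%E.
Proof.
move=> irr; have T0 : (0%:E <= irr_type x)%E.
  by apply/irr_type_ge/irrational_approximable => //; rewrite lexx ltr01.
rewrite leNgt; apply/negP => T1.
have Tfin : irr_type x \is a fin_num.
  by rewrite ge0_fin_numE// (lt_trans T1)// ltry.
move: T0 T1; rewrite -(fineK Tfin); set y := fine _; rewrite lee_fin lte_fin.
move=> y0 y1.
have /irr_type_ge : approximable x ((y + 1) / 2).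
  by apply: irrational_approximable => //; apply/andP; split; lra.
by rewrite -(fineK Tfin) lee_fin -/y; lra.
Qed.

(** * Numbers squeezed between Farey neighbours *)

Section farey.
Variable d : nat -> nat -> nat.

(** The stages [(p/q, r/s)] of the construction, starting from [0/1] and [1/1].
The multiplier may depend on the current left denominator [q], because it has to
be comparable with a power of it; it is the successor of [d m q], so that it is
always positive. *)
Fixpoint farey (n : nat) : (nat * nat) * (nat * nat) :=
  if n is m.+1 then
    let: ((p, q), (r, s)) := farey m in
    let a := (d m q).+1 in
    ((p + a * r, q + a * s), (p + a * r + r, q + a * s + s))%N
  else ((0, 1), (1, 1))%N.

Definition lnum n := (farey n).1.1.
Definition lden n := (farey n).1.2.
Definition rnum n := (farey n).2.1.
Definition rden n := (farey n).2.2.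

Lemma lnumS n : lnum n.+1 = (lnum n + (d n (lden n)).+1 * rnum n)%N.
Proof. by rewrite /lnum /rnum /lden /=; case: farey => -[? ?] [? ?]. Qed.

Lemma ldenS n : lden n.+1 = (lden n + (d n (lden n)).+1 * rden n)%N.
Proof. by rewrite /rden /lden /=; case: farey => -[? ?] [? ?]. Qed.

Lemma rnumS n : rnum n.+1 = (lnum n.+1 + rnum n)%N.
Proof. by rewrite /rnum /lnum /=; case: farey => -[? ?] [? ?]. Qed.

Lemma rdenS n : rden n.+1 = (lden n.+1 + rden n)%N.
Proof. by rewrite /rden /lden /=; case: farey => -[? ?] [? ?]. Qed.

(** Each step acts on the pair of fractions by an integer matrix of determinant
1; [farey_det_next] and [farey_det_right] are the same fact for the other pairs
of consecutive convergents. *)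
Lemma farey_det n : (rnum n * lden n = lnum n * rden n + 1)%N.
Proof.
by elim: n => // n IH; rewrite rnumS rdenS lnumS ldenS; nia.
Qed.

Lemma farey_det_next n : (rnum n * lden n.+1 = lnum n.+1 * rden n + 1)%N.
Proof. by have := farey_det n; rewrite lnumS ldenS; nia. Qed.

Lemma farey_det_right n : (rnum n * rden n.+1 = rnum n.+1 * rden n + 1)%N.
Proof. by have := farey_det_next n; rewrite rnumS rdenS; nia. Qed.

Lemma rden_bounds n : (n < lden n <= rden n)%N /\ (rden n <= 2 * lden n)%N.
Proof.
elim: n => // n [/andP[IH1 IH2] IH3].
by rewrite rdenS ldenS mulSn; split; last nia; apply/andP; split; nia.
Qed.

Lemma lden_gt n : (n < lden n)%N.
Proof. by have [/andP[]] := rden_bounds n. Qed.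

Lemma lden_gt0 n : (0 < lden n)%N.
Proof. exact: leq_ltn_trans (lden_gt n). Qed.

Lemma rden_gt0 n : (0 < rden n)%N.
Proof. by apply: leq_trans (lden_gt0 n) _; have [/andP[]] := rden_bounds n. Qed.

Lemma lden_bracket K Q : (lden K <= Q)%N ->
  exists2 k, (K <= k)%N & (lden k <= Q < lden k.+1)%N.
Proof.
move=> KQ.
have bnd i : (lden i <= Q)%N -> (i <= Q)%N.
  by move=> ?; apply/ltnW/(leq_trans (lden_gt i)).
have exP : exists i, (lden i <= Q)%N by exists K.
case: (ex_maxnP exP bnd) => k kQ kmax; exists k; first exact: kmax.
by rewrite kQ ltnNge; apply/negP => /kmax; rewrite ltnn.
Qed.

Variable R : realType.

Let left n : R := (lnum n)%:R / (lden n)%:R.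
Let right n : R := (rnum n)%:R / (rden n)%:R.

Let frac_le (a b c e : nat) : (0 < b)%N -> (0 < e)%N ->
  (a * e <= c * b)%N -> a%:R / b%:R <= c%:R / e%:R :> R.
Proof.
move=> b0 e0 H; rewrite ler_pdivrMr ?ltr0n// mulrAC ler_pdivlMr ?ltr0n//.
by rewrite -!natrM ler_nat.
Qed.

Let left_mono m n : (m <= n)%N -> left m <= left n.
Proof.
apply: (homo_leq (@lexx _ _) (@le_trans _ _)) => k.
by apply: frac_le; rewrite ?lden_gt0// lnumS ldenS; have := farey_det k; nia.
Qed.

Let right_mono m n : (m <= n)%N -> right n <= right m.
Proof.
apply: (homo_leq (r := fun x y : R => y <= x) (@lexx _ _)) => [y x z yx zy|k].
  exact: le_trans zy yx.
by apply: frac_le; rewrite ?rden_gt0//; have := farey_det_right k; nia.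
Qed.

Let left_le_right m n : left m <= right n.
Proof.
apply: (@le_trans _ _ (left (maxn m n))); first exact/left_mono/leq_maxl.
apply: (@le_trans _ _ (right (maxn m n))); last exact/right_mono/leq_maxr.
by apply: frac_le; rewrite ?lden_gt0 ?rden_gt0//; have := farey_det (maxn m n); nia.
Qed.

Definition farey_limit : R := sup (range left).

Lemma farey_limit_ge n : (lnum n)%:R <= (lden n)%:R * farey_limit.
Proof.
rewrite mulrC -ler_pdivrMr ?ltr0n ?lden_gt0//.
apply: ub_le_sup; last by exists n.
by exists (right 0) => _ [m _ <-]; exact: left_le_right.
Qed.

Lemma farey_limit_le n : (rden n)%:R * farey_limit <= (rnum n)%:R.
Proof.
rewrite mulrC -ler_pdivlMr ?ltr0n ?rden_gt0//.
apply: ge_sup; first by exists (left 0), 0%N.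
by move=> _ [m _ <-]; exact: left_le_right.
Qed.

(** The error of approximating the limit by the right fraction [r/s], multiplied
by [s]. *)
Definition gap n : R := (rnum n)%:R - (rden n)%:R * farey_limit.

(** The limit lies to the right of the next left fraction, which is at distance
[1 / (s * lden n.+1)] from [r/s]. *)
Lemma gap_le n : (lden n.+1)%:R * gap n <= 1.
Proof.
have := ler_wpM2l (ler0n R (rden n)) (farey_limit_ge n.+1).
have /(congr1 (fun k : nat => k%:R : R)) := farey_det_next n.
by rewrite natrD !natrM /gap => *; lra.
Qed.

(** The limit lies to the left of the next right fraction, which is at distance
[1 / (s * rden n.+1)] from [r/s]. *)
Lemma gap_ge n : 1 <= (rden n.+1)%:R * gap n.
Proof.
have := ler_wpM2l (ler0n R (rden n)) (farey_limit_le n.+1).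
have /(congr1 (fun k : nat => k%:R : R)) := farey_det_right n.
by rewrite natrD !natrM /gap => *; lra.
Qed.

Lemma gap_gt0 n : 0 < gap n.
Proof.
have := gap_ge n; rewrite -ler_pdivrMl ?ltr0n ?rden_gt0// mulr1.
by apply: lt_le_trans; rewrite invr_gt0 ltr0n rden_gt0.
Qed.

(** The law of best approximation.  The vectors [(p', q')] of the next left
fraction and [(r, s)] of the right fraction form a basis of the integer lattice,
so [(P, Q) = u (p', q') + v (r, s)] and
[Q x - P = u (q' x - p') - v (r - s x)], where both brackets are nonnegative.
For [0 < Q < q'] the coefficient [v] cannot vanish and [u] cannot have the same
sign as [v], so the two terms add up in absolute value. *)
Lemma gap_best n (Q : nat) (P : int) : (0 < Q < lden n.+1)%N ->
  gap n <= `|Q%:R * farey_limit - P%:~R|.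
Proof.
move=> /andP[Q0 Qlt].
set x := farey_limit.
pose u : int := (rnum n)%:Z * Q%:Z - (rden n)%:Z * P.
pose v : int := (lden n.+1)%:Z * P - (lnum n.+1)%:Z * Q%:Z.
have det : (rnum n)%:Z * (lden n.+1)%:Z = (lnum n.+1)%:Z * (rden n)%:Z + 1.
  by rewrite -!PoszM farey_det_next PoszD.
have Quv : Q%:Z = u * (lden n.+1)%:Z + v * (rden n)%:Z.
  have -> : u * (lden n.+1)%:Z + v * (rden n)%:Z =
      Q%:Z * ((rnum n)%:Z * (lden n.+1)%:Z - (lnum n.+1)%:Z * (rden n)%:Z).
    by rewrite /u /v; ring.
  by rewrite det; ring.
have Puv : P = u * (lnum n.+1)%:Z + v * (rnum n)%:Z.
  have -> : u * (lnum n.+1)%:Z + v * (rnum n)%:Z =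
      P * ((rnum n)%:Z * (lden n.+1)%:Z - (lnum n.+1)%:Z * (rden n)%:Z).
    by rewrite /u /v; ring.
  by rewrite det; ring.
have l0 : 0 <= (lden n.+1)%:R * x - (lnum n.+1)%:R by rewrite subr_ge0 farey_limit_ge.
have g0 := ltW (gap_gt0 n).
have E : Q%:R * x - P%:~R =
    u%:~R * ((lden n.+1)%:R * x - (lnum n.+1)%:R) - v%:~R * gap n.
  rewrite -[Q%:R]/(Q%:Z%:~R) Quv Puv /gap -/x !(intrD, intrM) -!pmulrn; ring.
have rd0 := rden_gt0 n; have ld0 := lden_gt0 n.+1.
rewrite E.
have [v0|v0|v0] := ltgtP v 0.
- have u1 : (1 <= u :> int) by nia.
  have : 1 <= u%:~R :> R by rewrite ler1z.
  have : v%:~R <= (-1 : int)%:~R :> R by rewrite ler_int; lia.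
  rewrite mulrN1z => ? ?; apply: le_trans (ler_norm _); nra.
- have u1 : (u <= 0 :> int) by nia.
  have : u%:~R <= 0 :> R by rewrite lerz0.
  have : 1 <= v%:~R :> R by rewrite ler1z.
  move=> ? ?; rewrite distrC; apply: le_trans (ler_norm _); nra.
- exfalso; move: Quv Q0 Qlt; rewrite v0 mul0r addr0.
  move: (u) (lden n.+1) => w l; clear=> Qwl Q0 Ql.
  by have [w0|w1] : w <= 0 \/ 1 <= w; [lia|nia|nia].
Qed.

(** [gap_best] keeps every [|Q x - P|] away from 0. *)
Lemma farey_limit_irrational : irrational farey_limit.
Proof.
move=> /rationalP[P [Q]]; have [->|Q0] := posnP Q.
  rewrite invr0 mulr0 => x0.
  (* A zero denominator stands for the rational 0. *)
  have := @gap_best 0 1 0 (lden_gt 1); rewrite x0 mulr0 subr0 normr0.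
  by rewrite leNgt gap_gt0.
move=> xPQ; have Qlt : (0 < Q < lden Q.+1)%N.
  by rewrite Q0 (ltn_trans _ (lden_gt _)).
have := gap_best P Qlt.
by rewrite xPQ mulrC divfK ?pnatr_eq0 -?lt0n// subrr normr0 leNgt gap_gt0.
Qed.

End farey.

Lemma eq_farey (d1 d2 : nat -> nat -> nat) n :
  (forall m, (m < n)%N -> d1 m =1 d2 m) -> farey d1 n = farey d2 n.
Proof.
elim: n => //= n IH eqd; rewrite IH => [|m mn]; last by apply: eqd; exact: ltnW.
by case: farey => -[p q] [r s]; rewrite eqd.
Qed.

(** Both limits lie in the interval [[p/q, r/s]], whose length [1/(q s)] is at
most [1/(n + 1)]. *)
Lemma farey_limit_close (R : realType) (d1 d2 : nat -> nat -> nat) n :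
  farey d1 n = farey d2 n ->
  `|farey_limit d1 R - farey_limit d2 R| <= n.+1%:R^-1.
Proof.
move=> eqf; have := farey_limit_ge d1 R n; have := farey_limit_le d1 R n.
have := farey_limit_ge d2 R n; have := farey_limit_le d2 R n.
have := lden_gt d1 n; have := rden_gt0 d1 n; have := farey_det d1 n.
rewrite /lnum /lden /rnum /rden -eqf.
case: farey => -[p q] [r s] /= det s0 nq.
set x1 := farey_limit d1 R; set x2 := farey_limit d2 R => H1 H2 H3 H4.
have {}det : r%:R * q%:R = p%:R * s%:R + 1 :> R by rewrite -!natrM det natrD.
have {}s0 : 1 <= s%:R :> R by rewrite ler1n.
have {}nq : n.+1%:R <= q%:R :> R by rewrite ler_nat.
have n0 : 0 < n.+1%:R :> R by rewrite ltr0n.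
rewrite -[leRHS]div1r ler_pdivlMr// mulrC -{1}(gtr0_norm n0) -normrM.
have q0 : 0 < q%:R :> R by apply: lt_le_trans nq.
apply: (@le_trans _ _ `|(q%:R * s%:R) * (x1 - x2)|).
  rewrite !normrM; apply: ler_wpM2r => //.
  by rewrite -normrM !ger0_norm ?mulr_ge0 ?ler0n//; nra.
rewrite ler_norml; apply/andP; split; nra.
Qed.

(** * A number whose type is a given upper limit *)

(** Rational separation of extended reals, including infinite ones. *)
Lemma ereal_between_rat (R : realType) (x y : \bar R) : (x < y)%E ->
  exists t : rat, (x < (ratr t)%:E < y)%E.
Proof.
have rat_between (a b : R) : a < b -> exists t : rat, a < ratr t < b.
  by move=> /rat_in_itvoo[t]; rewrite in_itv /=; exists t.
move: x y => [a| |] [b| |] //=.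
- by rewrite lte_fin => /rat_between[t]; exists t; rewrite !lte_fin.
- have [|t /andP[at_ _]] := rat_between a (a + 1); first by rewrite ltrDl.
  by exists t; rewrite lte_fin at_ ltry.
- have [|t /andP[_ tb]] := rat_between (b - 1) b; first by rewrite gtrBl.
  by exists t; rewrite lte_fin tb ltNyr.
- by exists 0; rewrite ltNyr ltry.
Qed.

Section prescribed_type.
Variables (R : realType) (h : nat -> R).
Hypothesis h_ge1 : forall n, 1 <= h n.

(** With the multiplier [power_digit n q + 1], which is [q^(h n - 1)] up to an
error of at most 1, the next left denominator is comparable to [q^(h n)]. *)
Definition power_digit (n q : nat) : nat := Num.truncn ((q%:R : R) `^ (h n - 1)).

Definition number_of_exponents : R := farey_limit power_digit R.

Let q n := lden power_digit n.
Let s n := rden power_digit n.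

Let q_ge1 n : 1 <= (q n)%:R :> R.
Proof. by rewrite ler1n lden_gt0. Qed.

Let powq n : (q n)%:R * (q n)%:R `^ (h n - 1) = (q n)%:R `^ h n :> R.
Proof. by rewrite mulr_powRB1 ?ler0n// (lt_le_trans ltr01). Qed.

Let lden_growth n : (q n)%:R `^ h n <= (q n.+1)%:R :> R.
Proof.
rewrite -powq /q ldenS -/(q n) -/(s n) natrD natrM mulrC.
have qs : (q n)%:R <= (s n)%:R :> R.
  by rewrite ler_nat; have [/andP[]] := rden_bounds power_digit n.
have := truncnS_gt ((q n)%:R `^ (h n - 1)); have := q_ge1 n.
have := powR_ge0 ((q n)%:R : R) (h n - 1).
rewrite -/(power_digit n (q n)); nra.
Qed.

(** The constant: [s <= 2 q] at every stage, and
[lden n.+1 <= q + (q^(h n - 1) + 1) * 2 q <= 5 q^(h n)]. *)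
Let rden_growth n : (s n.+1)%:R <= 10 * (q n)%:R `^ h n :> R.
Proof.
have s2 m : (s m)%:R <= 2 * (q m)%:R :> R.
  by rewrite -natrM ler_nat; have [] := rden_bounds power_digit m.
apply: (le_trans (s2 n.+1)).
have -> : (10 : R) = 2 * 5 by lra.
rewrite -mulrA ler_pM2l// -powq {1}/q ldenS -/(q n) -/(s n) natrD natrM -natr1.
have e0 : 0 <= h n - 1 by rewrite subr_ge0.
have := @truncn_le _ ((q n)%:R `^ (h n - 1)); rewrite powR_ge0.
rewrite -/(power_digit n (q n)).
have := q_ge1 n; have := s2 n; have := ler0n R (power_digit n (q n)).
have := ler_powR (q_ge1 n) e0; rewrite powRr0.
by move=> *; nra.
Qed.

(** A denominator [Q] between [q n] and [q n.+1] has
[Q^t * |Q x - P| >= (q n)^t * gap n >= (q n)^t / (10 (q n)^(h n))], which is at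
least [1/10] as soon as [h n <= t]. *)
Lemma exponents_not_approximable (t : R) :
  (exists N, forall n, (N <= n)%N -> h n <= t) ->
  ~ approximable number_of_exponents t.
Proof.
move=> [N hN] /(_ 10^-1 _ (q N))[|Q [P [NQ]]]; first by rewrite invr_gt0.
apply/negP; rewrite -leNgt.
have t0 : 0 <= t by apply: le_trans (hN _ (leqnn N)); apply: le_trans (h_ge1 N).
have [n Nn /andP[qQ Qq]] := lden_bracket NQ.
have Q0 : (0 < Q < q n.+1)%N by rewrite Qq (leq_trans (lden_gt0 _ _) qQ).
apply: (@le_trans _ _ ((q n)%:R `^ t * gap power_digit R n)); last first.
  apply: ler_pM; rewrite ?powR_ge0 ?(ltW (gap_gt0 _ _ _))//.
    by apply: ge0_ler_powR; rewrite ?nnegrE ?ler0n ?ler_nat.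
  exact: gap_best.
have g1 := gap_ge power_digit R n; have g0 := gap_gt0 power_digit R n.
rewrite -[leLHS]mulr1 ler_pdivrMl//.
apply: (le_trans g1); rewrite mulrA ler_pM2r//.
apply: le_trans (rden_growth n) _; rewrite ler_pM2l//.
by apply: ler_powR => //; exact: hN.
Qed.

(** The right fraction [r/s] of a stage with [h n >= t'] satisfies
[s^t * |s x - r| <= (2 q)^t / q^(h n) <= 2^t / q^(t' - t)], which is small for
large [n]. *)
Lemma exponents_approximable (t t' : R) : 0 <= t < t' ->
  (forall N, exists2 n, (N <= n)%N & t' <= h n) ->
  approximable number_of_exponents t.
Proof.
move=> /andP[t0 tt'] hN e e0 N.
have [N1 HN1] : exists N1 : nat, forall k : nat, (N1 <= k)%N ->
    e^-1 * 2 `^ t < (k%:R : R) `^ (t' - t) by apply: powR_unbounded; rewrite subr_gt0.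
have [n Nn t'h] := hN (maxn N N1); move: Nn; rewrite geq_max => /andP[Nn N1n].
have [/andP[nq qs] s2q] := rden_bounds power_digit n.
rewrite -/(q n) -/(s n) in nq qs s2q.
exists (s n), (rnum power_digit n)%:Z; split.
  by rewrite (leq_trans Nn)// (leq_trans (ltnW nq)).
rewrite distrC ger0_norm; last exact: ltW (gap_gt0 _ _ n).
rewrite -[_ - _]/(gap power_digit R n).
have g0 := gap_gt0 power_digit R n.
have q0 : 0 < (q n)%:R :> R by exact: lt_le_trans (q_ge1 n).
apply: (@le_lt_trans _ _ ((2 * (q n)%:R) `^ t * gap power_digit R n)).
  rewrite ler_pM2r//; apply: ge0_ler_powR; rewrite ?nnegrE ?mulr_ge0 ?ler0n//.
  by rewrite -natrM ler_nat.
have qt'0 : 0 < (q n)%:R `^ t' :> R by rewrite powR_gt0.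
rewrite -(ltr_pM2l qt'0).
apply: (@le_lt_trans _ _ ((2 * (q n)%:R) `^ t)).
  rewrite mulrCA -[leRHS]mulr1; apply: ler_wpM2l; first exact: powR_ge0.
  apply: le_trans (gap_le power_digit R n); rewrite ler_pM2r//.
  by apply: le_trans (lden_growth n); exact: ler_powR.
have qt' : (q n)%:R `^ t' = (q n)%:R `^ (t' - t) * (q n)%:R `^ t :> R.
  by rewrite -powRD ?subrK//; apply/implyP => _; rewrite gt_eqF.
rewrite qt' powRM ?ler0n// mulrAC ltr_pM2r ?powR_gt0// mulrC -ltr_pdivrMl//.
exact: HN1 (leq_trans N1n (ltnW nq)).
Qed.

(** The two hypotheses on [y] say that [y] is the upper limit of [h].  The lower
bound on the type is used to know that an exponent between the type and [y] is
nonnegative. *)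
Lemma exponents_irr_type (y : \bar R) : (1%:E <= y)%E ->
  (forall t, (y < t%:E)%E -> exists N, forall n, (N <= n)%N -> h n <= t) ->
  (forall t, (t%:E < y)%E -> forall N, exists2 n, (N <= n)%N & t <= h n) ->
  irr_type number_of_exponents = y.
Proof.
move=> y1 up lo.
have irr : irrational number_of_exponents by exact: farey_limit_irrational.
have T1 := irr_type_ge1 irr.
apply/eqP; rewrite eq_le; apply/andP; split; rewrite leNgt; apply/negP.
  move=> /ereal_between_rat[t /andP[yt]]; rewrite ltNge => /negP; apply.
  by apply: irr_type_le; apply: exponents_not_approximable; exact: up.
move=> /ereal_between_rat[t /andP[Tt ty]].
have [t' /andP[tt' t'y]] := ereal_between_rat ty; rewrite lte_fin in tt'.
move: (Tt); rewrite ltNge => /negP; apply.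
apply: irr_type_ge; apply: (@exponents_approximable _ (ratr t')); last exact: lo.
rewrite tt' andbT; move: (le_lt_trans T1 Tt); rewrite lte_fin; lra.
Qed.

End prescribed_type.

(** * Exponents from a family of closed subsets of the Cantor space *)

Definition cylinder (x : cantor_space) (n : nat) : set cantor_space :=
  [set y | forall i, (i < n)%N -> y i = x i].

Lemma cylinder_le (x : cantor_space) m n : (m <= n)%N ->
  cylinder x n `<=` cylinder x m.
Proof. by move=> mn y xy i im; apply: xy; exact: leq_trans mn. Qed.

Lemma cylinder_eq (x y : cantor_space) n : cylinder x n y ->
  cylinder y n = cylinder x n.
Proof. by move=> xy; apply/seteqP; split => z zn i im; rewrite zn// xy. Qed.

Lemma nbhs_cylinder (x : cantor_space) n : nbhs x (cylinder x n).
Proof.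
elim: n => [|n IH]; first by apply: filterS filterT => y _ i.
have nb : nbhs x ((fun y : cantor_space => y n) @^-1` [set x n]).
  exact: (@proj_continuous nat (fun=> bool) n x _ (discrete_set1 _)).
apply: filterS (filterI IH nb) => y [yn ynn] i.
by rewrite ltnS leq_eqVlt => /predU1P[->|/yn].
Qed.

Lemma nbhs_cantorP (x : cantor_space) (U : set cantor_space) :
  nbhs x U -> exists n, cylinder x n `<=` U.
Proof.
pose G := filter_from [set: nat] (cylinder x).
have GF : Filter G.
  apply: filter_from_filter; first by exists 0%N.
  move=> i j _ _; exists (maxn i j) => // y yij; split.
    exact: cylinder_le (leq_maxl _ _) _ yij.
  exact: cylinder_le (leq_maxr _ _) _ yij.
suff : G --> x by move=> /[apply] -[n _]; exists n.
apply/cvg_sup => i A; rewrite nbhsE => -[_ [[B oB <-] Bx] BA].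
by exists i.+1 => // y yi; apply: BA; rewrite /= yi.
Qed.

Lemma closed_cylinder (x : cantor_space) (F : set cantor_space) :
  closed F -> ~ F x -> exists n, cylinder x n `<=` ~` F.
Proof.
move=> cF Fx; apply: nbhs_cantorP; apply: open_nbhs_nbhs; split => //.
exact: closed_openC.
Qed.

Section exponents_of_function.
Variables (R : realType) (C : nat -> set cantor_space) (rho : nat -> R).
Hypothesis closedC : forall i, closed (C i).

Let Z m := \bigcup_(i in [set i | (i <= m)%N /\ rho i <= rho m]) C i.

Let closedZ m : closed (Z m).
Proof.
apply: closed_bigcup => //; apply: (@sub_finite_set _ _ `I_m.+1) => //.
by move=> i [].
Qed.

Let miss (m : nat) (x : cantor_space) (n : nat) := cylinder x n `<=` ~` Z m.

(** Each [C i] contained in [Z m] certifies a value below [rho m].  The index [m]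
fires at the first time [n >= m] at which the first [n] bits of [x] show that
[x] is outside [Z m].  The wait until time [m] makes the finite maximum in
[exponent] see every firing. *)
Definition fires (m : nat) (x : cantor_space) (n : nat) : Prop :=
  [/\ (m <= n)%N, miss m x n & n = m \/ ~ miss m x n.-1].

Definition exponent (x : cantor_space) (n : nat) : R :=
  \big[Num.max/1]_(m < n.+1 | `[< fires m x n >]) rho m.

Lemma exponent_ge1 x n : 1 <= exponent x n.
Proof. by apply: bigmax_ge_id. Qed.

(** Everything in the definition of [exponent x n] is read off from cylinders of
length at most [n]. *)
Lemma eq_exponent x y n : cylinder x n y -> exponent y n = exponent x n.
Proof.
move=> xy; apply: eq_bigl => m; rewrite /fires /miss (cylinder_eq xy).
by rewrite (cylinder_eq (cylinder_le (leq_pred n) xy)).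
Qed.

Let miss_le m x n k : (n <= k)%N -> miss m x n -> miss m x k.
Proof. by move=> nk /(subset_trans _); apply; exact: cylinder_le. Qed.

(** An index fires at most once. *)
Let eventually_not_fires i x : exists N, forall m n, (m < i)%N -> (N <= n)%N ->
  ~ fires m x n.
Proof.
elim: i => [|i [N HN]]; first by exists 0%N.
have [[k ik]|nomiss] := pselect (exists k, miss i x k).
  exists (maxn N (maxn i k).+1) => m n; rewrite ltnS geq_max leq_eqVlt.
  move=> /predU1P[->|mi] /andP[Nn kn]; last exact: HN.
  case: n kn Nn => // n; rewrite ltnS geq_max => /andP[le_in kn] _.
  case=> _ _ [ni|]; first by move: le_in; rewrite -ni ltnn.
  by apply; exact: miss_le ik.
exists N => m n; rewrite ltnS leq_eqVlt => /predU1P[->|mi] Nn; last exact: HN.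
by case=> _ ? _; apply: nomiss; exists n.
Qed.

(** Membership in [C i] prevents every [m >= i] with [rho m >= rho i] from
firing, and the finitely many smaller indices eventually stop. *)
Lemma exponent_le x i t : C i x -> rho i <= t -> 1 <= t ->
  exists N, forall n, (N <= n)%N -> exponent x n <= t.
Proof.
move=> Cx it t1; have [N HN] := eventually_not_fires i x.
exists N => n Nn; apply/bigmax_leP; split => // m /asboolP fm.
rewrite leNgt; apply/negP => tm.
have [mi|im] := ltnP m i; first exact: HN fm.
case: fm => _ /(_ x) + _; apply; first by move=> ?.
by exists i => //; split => //; exact: ltW (le_lt_trans it tm).
Qed.

(** Under this hypothesis [x] is outside the closed set [Z m], so [m] fires. *)
Lemma exponent_ge x m :
  (forall i, rho i <= rho m -> ~ C i x) ->
  exists2 n, (m <= n)%N & rho m <= exponent x n.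
Proof.
move=> nC; have nZ : ~ Z m x by move=> [i [_ im]]; exact: nC.
have [k mk] := closed_cylinder (@closedZ m) nZ.
have ex : exists n, (m <= n)%N && `[< miss m x n >].
  exists (maxn m k); rewrite leq_maxl; apply/asboolP; apply: miss_le mk.
  exact: leq_maxr.
case: (ex_minnP ex) => n /andP[mn /asboolP missn] nmin; exists n => //.
apply: (@le_bigmax_cond _ _ _ _ (Ordinal (mn : (m < n.+1)%N)) _ rho).
apply/asboolP; split => //=.
have [->|nm] := eqVneq n m; first by left.
right=> missn1; have {}mn : (m < n)%N by rewrite ltn_neqAle eq_sym nm.
have := nmin n.-1; rewrite (introT (asboolP _) missn1) andbT.
by move: mn; lia.
Qed.

End exponents_of_function.

(** * The type function is complete *)

Lemma irr_type_upper_semi_Baire1 (R : realType) :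
  upper_semi_Baire1 (X := set_type (@irrational R))
    `[1%E, +oo%E] (fun alpha => irr_type (set_val alpha)).
Proof.
split=> [[x xirr]|r].
  by rewrite /= in_itv /= leey andbT; apply: irr_type_ge1; exact: set_mem.
pose code i : nat * nat * nat := odflt (0, 0, 0)%N (unpickle i).
exists (fun i => [set x : set_type (@irrational R) |
    forall q : nat, ((code i).2 <= q)%N -> forall n : int,
    (code i).1.2.+1%:R^-1 <=
    q%:R `^ (r - (code i).1.1.+1%:R^-1) * `|q%:R * set_val x - n%:~R|]).
  by move=> i; exact: closed_separated.
apply/seteqP; split=> x /=.
  rewrite in_itv /= leNye /= => /irr_type_lt[k].
  move=> /not_approximable_separated[j [N sep]].
  by exists (pickle (k, j, N)) => //=; rewrite /code pickleK.
move=> [i _ /= sep]; rewrite in_itv /= leNye /=.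
have /irr_type_le : ~ approximable (set_val x) (r - (code i).1.1.+1%:R^-1).
  by apply/not_approximable_separated; exists (code i).1.2, (code i).2.
move=> /le_lt_trans; apply.
by rewrite lte_fin gtrBl invr_gt0 ltr0n.
Qed.

(** The 2-adic valuation takes every value at arbitrarily large arguments, so
composing it with an enumeration repeats each element infinitely often. *)
Lemma recurrent_enumeration (T : countType) (t0 : T) :
  exists code : nat -> T, forall t N, exists2 m, (N <= m)%N & code m = t.
Proof.
exists (fun m => odflt t0 (unpickle (logn 2 m))) => t N.
exists (2 ^ pickle t * N.*2.+1)%N.
  by rewrite -[X in (X <= _)%N]mul1n leq_mul ?expn_gt0// -addnn; lia.
rewrite lognM ?expn_gt0// pfactorK// logn_coprime ?addn0 ?pickleK//.
by rewrite coprime2n /= odd_double.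
Qed.

(** A function of upper semi-Baire class 1 is the upper limit of a sequence of
functions depending on finitely many bits. *)
Lemma upper_semi_Baire1_exponents (R : realType) (g : cantor_space -> \bar R) :
  upper_semi_Baire1 `[1%E, +oo%E] g ->
  exists h : cantor_space -> nat -> R,
    [/\ forall x n, 1 <= h x n,
        forall x y n, cylinder x n y -> h y n = h x n,
        forall x t, (g x < t%:E)%E -> exists N, forall n, (N <= n)%N -> h x n <= t
      & forall x t, (t%:E < g x)%E -> forall N, exists2 n, (N <= n)%N & t <= h x n].
Proof.
move=> [gK gF].
have g_ge1 x : (1%:E <= g x)%E by have := gK x; rewrite /= in_itv /= => /andP[].
have /choice[F HF] : forall r : rat, exists F : nat -> set cantor_space,
    (forall i, closed (F i)) /\
    forall x, (g x < (ratr r)%:E)%E <-> exists i, F i x.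
  move=> r; have [F cF gE] := gF (ratr r); exists F; split=> // x.
  have -> : (g x < (ratr r)%:E)%E = (g @^-1` `[-oo%E, (ratr r)%:E[) x :> Prop.
    by rewrite /= in_itv /= leNye.
  by rewrite gE; split=> [[i _ ?]|[i ?]]; exists i.
have [code codeP] := recurrent_enumeration ((0, 0%N) : rat * nat).
pose C m := F (code m).1 (code m).2; pose rho m : R := ratr (code m).1.
have Crho m x : C m x -> (g x < (rho m)%:E)%E.
  by move=> Cx; apply/(HF _).2; exists (code m).2.
have cC m : closed (C m) by exact: (HF _).1.
exists (exponent C rho); split.
- exact: exponent_ge1.
- by move=> x y n; exact: eq_exponent.
- move=> x t gt; have [r /andP[gr rt]] := ereal_between_rat gt.
  have [i Fi] := ((HF r).2 x).1 gr.
  have [m _ codem] := codeP (r, i) 0%N.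
  apply: (@exponent_le _ C rho _ m).
  + by rewrite /C codem.
  + by rewrite /rho codem /= ltW// -lte_fin.
  + by rewrite -lee_fin; apply: le_trans (g_ge1 x) (ltW gt).
- move=> x t tg N; have [r /andP[tr rg]] := ereal_between_rat tg.
  have [m Nm codem] := codeP (r, 0%N) N.
  have rhom : rho m = ratr r by rewrite /rho codem.
  have [|n mn rn] := @exponent_ge _ C rho cC x m.
    move=> i; rewrite rhom => ir /Crho; apply/negP; rewrite -leNgt ltW//.
    by apply: le_lt_trans rg; rewrite lee_fin.
  exists n; first exact: leq_trans mn.
  by rewrite (le_trans _ rn)// rhom ltW// -lte_fin.
Qed.

Lemma number_of_exponents_continuous (R : realType)
    (h : cantor_space -> nat -> R) :
  (forall x y n, cylinder x n y -> h y n = h x n) ->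
  continuous (fun x => number_of_exponents (h x)).
Proof.
move=> hloc x; apply/cvgrPdist_lt => e e0.
pose n := Num.truncn e^-1.
have ne : n.+1%:R^-1 < e.
  by rewrite -[ltRHS]invrK ltf_pV2 ?posrE ?invr_gt0// truncnS_gt.
apply: filterS (nbhs_cylinder x n) => y xy; apply: le_lt_trans ne.
apply: farey_limit_close; apply: eq_farey => m mn q.
by rewrite /power_digit (hloc x y)//; exact: cylinder_le (ltnW mn) _ xy.
Qed.

Theorem theorem1p4 (R : realType) :
  upper_semi_Baire1_complete (X := set_type (@irrational R))
    `[1%E, +oo%E] (fun alpha => irr_type (set_val alpha)).
Proof.
split; first exact: irr_type_upper_semi_Baire1.
move=> g gB; have [h [h1 hloc up lo]] := upper_semi_Baire1_exponents gB.
have irr x : number_of_exponents (h x) \in (@irrational R).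
  by apply/mem_set; exact: farey_limit_irrational.
exists (fun x => exist _ (number_of_exponents (h x)) (irr x)); split.
  apply: continuous_comp_initial; exact: number_of_exponents_continuous.
apply/funext => x /=; apply/esym/exponents_irr_type => //.
- by case: gB => /(_ x); rewrite /= in_itv /= => /andP[].
- exact: up.
- exact: lo.
Qed.
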